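(* For any fixed $n\ge 1$, the sequences $$\ell_{2n,1}^{\mathrm{dhook}},\ \ell_{2n,2}^{\mathrm{dhook}},\dots,\ell_{2n,n}^{\mathrm{dhook}}\quad\text{and}\quad i_{2n,1}^{\mathrm{dhook}},\ i_{2n,2}^{\mathrm{dhook}},\dots,i_{2n,n}^{\mathrm{dhook}}$$ are log concave.
   Context: $\mathfrak S_{2n}$ is the set of permutations of $\{1,\dots,2n\}$. For $\pi\in\mathfrak S_{2n}$, $\ell(\pi)$ is the length of a longest increasing subsequence of $\pi$ (in one-line notation). The shape $\operatorname{sh}\pi$ is the common shape (a partition of $2n$) of the two standard Young tableaux associated with $\pi$ by the Robinson–Schensted correspondence. Let $\mathrm{dhook}$ be the set of double hooks, i.e. the partitions of $2n$ of the form $(k^2,1^{2n-2k})=(k,k,1,\dots,1)$ with $1\le k\le n$ (two parts equal to $k$ followed by $2n-2k$ parts equal to $1$). Then $\ell_{2n,k}^{\mathrm{dhook}}$ is the number of $\pi\in\mathfrak S_{2n}$ with $\ell(\pi)=k$ and $\operatorname{sh}\pi\in\mathrm{dhook}$, and $i_{2n,k}^{\mathrm{dhook}}$ is the number of involutions $\pi\in\mathfrak S_{2n}$ (permutations whose square is the identity) with $\ell(\pi)=k$ and $\operatorname{sh}\pi\in\mathrm{dhook}$. A sequence of real numbers $l_1,\dots,l_n$ is log concave if $l_{k-1}l_{k+1}\le l_k^2$ for all $1\le k\le n$, with the convention $l_0=l_{n+1}=0$. *)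

(* Defs.v *)
From mathcomp Require Import all_boot all_order all_fingroup all_algebra.
From mathcomp Require Import reals.

Set Implicit Arguments.
Unset Strict Implicit.
Unset Printing Implicit Defensive.

(* A tableau is the list of its rows, from top to bottom (English notation). *)
Definition tableau := seq (seq nat).

(* Schensted row insertion: [x] replaces the leftmost entry [y > x] of the row,
   and [y] is bumped out; if there is no such entry, [x] is appended. *)
Fixpoint row_insert (r : seq nat) (x : nat) : seq nat * option nat :=
  if r is y :: r' then
    if x < y then (x :: r', Some y)
    else let: (r'', b) := row_insert r' x in (y :: r'', b)
  else ([:: x], None).

(* The second component is the index of the row in which the new cell appears. *)
Fixpoint tab_insert (t : tableau) (x : nat) : tableau * nat :=
  if t is r :: t' then
    match row_insert r x with
    | (r', Some y) => let: (t'', i) := tab_insert t' y in (r' :: t'', i.+1)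
    | (r', None) => (r' :: t', 0)
    end
  else ([:: [:: x]], 0).

Definition add_cell (t : tableau) (i x : nat) : tableau :=
  set_nth [::] t i (rcons (nth [::] t i) x).

(* One step, reading the [jx.1]-th letter [jx.2], on a pair (insertion tableau,
   recording tableau). *)
Definition rs_step (PQ : tableau * tableau) (jx : nat * nat) :
    tableau * tableau :=
  let: (P, i) := tab_insert PQ.1 jx.2 in (P, add_cell PQ.2 i jx.1).

Definition RS (w : seq nat) : tableau * tableau :=
  foldl rs_step ([::], [::]) (zip (iota 1 (size w)) w).

Lemma shape_tab_insert t x :
  shape (tab_insert t x).1 = incr_nth (shape t) (tab_insert t x).2.
Proof.
elim: t x => [|r t IH] x //=.
have szr : size (row_insert r x).1
    = size r + ((row_insert r x).2 == None).
  elim: r => //= y r IHr; case: ifP => _ /=; first by rewrite addn0.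
  by case: row_insert IHr => r'' b /= ->; rewrite addSn.
case: row_insert szr => r' [y|] /= szr; last by rewrite szr addn1.
by have := IH y; case: tab_insert => t'' i /= ->; rewrite szr addn0.
Qed.

Lemma shape_add_cell t i x : shape (add_cell t i x) = incr_nth (shape t) i.
Proof.
apply: (@eq_from_nth _ 0) => [|j _].
  rewrite size_incr_nth !size_map size_set_nth; case: ltnP => h.
    exact/maxn_idPr.
  by apply/maxn_idPl; apply: leqW.
have nthE s k : nth 0 (shape s) k = size (nth [::] s k : seq nat).
  case: (ltnP k (size s)) => h; first exact: nth_map.
  by rewrite !nth_default ?size_map.
rewrite nth_incr_nth !nthE nth_set_nth /= eq_sym.
by case: eqP => [->|]; rewrite ?size_rcons.
Qed.

Lemma shape_RS w : shape (RS w).1 = shape (RS w).2.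
Proof.
suff RSE s PQ : shape PQ.1 = shape PQ.2 ->
    shape (foldl rs_step PQ s).1 = shape (foldl rs_step PQ s).2 by exact: RSE.
elim: s PQ => [|[j x] s IH] [P Q] //= PQ; apply: IH; rewrite /rs_step /=.
have := shape_tab_insert P x; case: tab_insert => P' i /= ->.
by rewrite shape_add_cell PQ.
Qed.

Definition one_line (m : nat) (p : 'S_m) : seq nat :=
  [seq (p i).+1 | i <- enum 'I_m].

Definition sh (m : nat) (p : 'S_m) : seq nat := shape (RS (one_line p)).1.

(* A subsequence of [p] is identified with its set [A] of positions. *)
Definition increasing_on (m : nat) (p : 'S_m) (A : {set 'I_m}) : bool :=
  [forall i in A, forall j in A, (i < j) ==> (p i < p j)].

Definition lis (m : nat) (p : 'S_m) : nat :=
  \max_(A : {set 'I_m} | increasing_on p A) #|A|.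

Definition double_hook (n k : nat) : seq nat :=
  [:: k; k] ++ nseq (2 * n - 2 * k) 1.

Definition dhook (n : nat) : pred (seq nat) :=
  fun la => [exists k : 'I_n.+1, (1 <= k) && (la == double_hook n k)].

Definition ell_dhook (n k : nat) : nat :=
  #|[set p : 'S_(2 * n) | (lis p == k) && (sh p \in dhook n)]|.

Definition inv_dhook (n k : nat) : nat :=
  #|[set p : 'S_(2 * n) |
      [&& (p * p == 1)%g, lis p == k & sh p \in dhook n]]|.

Section LogConcave.
Import GRing.Theory Num.Theory.
Local Open Scope ring_scope.

(* The finite sequence l_1, ..., l_n, extended by zero. *)
Definition zero_ext (R : numDomainType) (n : nat) (l : nat -> R) (k : nat) : R :=
  if (1 <= k <= n)%N then l k else 0.

Definition log_concave (R : numDomainType) (n : nat) (l : nat -> R) : Prop :=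
  forall k : nat, (1 <= k <= n)%N ->
    zero_ext n l k.-1 * zero_ext n l k.+1 <= zero_ext n l k ^+ 2.

End LogConcave.

(* Main.v *)
(* Label each Robinson-Schensted step by the row of the cell it creates: 0 for
   no cell, r+1 for a cell in row r. On the grid of positions and values, the
   labels on the two outgoing edges of a square depend on the incoming ones
   through Fomin's edge-local rule, which is symmetric and reversible. Hence a
   permutation is encoded by two lattice words of equal content, the content
   being its shape, and inversion exchanges the two words. So, writing f for the
   number of lattice words of content (k, k, 1^(2n-2k)), the two sequences are
   f^2 (using Schensted's theorem that the first row has length lis) and f, and
   the hook length formula for f shows that f is log concave in k. *)
Require Import Defs.
From mathcomp Require Import all_boot all_order all_fingroup all_algebra.
From mathcomp Require Import reals.
From mathcomp Require Import zify ring lra.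

Set Implicit Arguments.
Unset Strict Implicit.
Unset Printing Implicit Defensive.

(** * Growth grids *)

(* A label is 0 on an edge crossed by no growth, and r+1 on an edge whose crossing
   adds a cell to row r; [h] and [v] come into a square of the grid, which
   contains a point of the permutation when [m] holds. *)
Definition cross (h v : nat) (m : bool) : nat * nat :=
  if h == v then let x := if h == 0 then m : nat else h.+1 in (x, x) else (h, v).

(** The local rule read backwards. Equal labels 0 and equal labels 1 both go back to 0, and
    [crossing] tells the two cases apart. *)
Definition uncross (h v : nat) : nat * nat :=
  if h == v then (h.-1, h.-1) else (h, v).

Definition crossing (h v : nat) : bool := (h == 1) && (v == 1).

Lemma crossC h v m : cross v h m = ((cross h v m).2, (cross h v m).1).
Proof. by rewrite /cross eq_sym; case: eqP => [->|]. Qed.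

Lemma uncrossK h v :
  cross (uncross h v).1 (uncross h v).2 (crossing h v) = (h, v).
Proof.
rewrite /uncross /cross /crossing.
have [<-|nhv] := eqVneq h v; last first.
  by rewrite /= (negPf nhv).
by rewrite /= eqxx andbb; case: h => [|[|h]].
Qed.

(** [cross] looks at [m] only when both incoming labels are 0; a point in any other square would
    leave no trace, hence the hypothesis. *)
Lemma crossK h v (m : bool) : (m -> h = 0 /\ v = 0) ->
  let: (h', v') := cross h v m in
  uncross h' v' = (h, v) /\ crossing h' v' = m.
Proof.
rewrite /cross /uncross /crossing => hm.
have [->|nhv] /= := eqVneq h v.
  have [v0|v0] := eqVneq v 0; first by rewrite v0 !eqxx; case: (m).
  rewrite eqxx andbb; split=> //.
  by case: m hm => [[] // _ /eqP|_]; [rewrite (negPf v0) | case: (v) v0].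
rewrite (negPf nhv); split=> //; case: m hm => [[] // h0 v0|_].
  by rewrite h0 v0 eqxx in nhv.
by apply/andP => -[/eqP h1 /eqP v1]; rewrite h1 v1 eqxx in nhv.
Qed.

Section Grid.
Variables (st : nat -> nat -> nat -> nat -> nat * nat) (h0 v0 : nat -> nat).

(** Positions run to the right and values upwards: [gridH i j] labels the bottom edge and
    [gridV i j] the left edge of square (i, j). [scan] climbs column [i], whose left labels are
    [v]. *)
Fixpoint scan (i : nat) (v : nat -> nat) (j : nat) : nat :=
  if j is j'.+1 then (st i j' (scan i v j') (v j')).1 else h0 i.

Fixpoint gridV (i : nat) : nat -> nat :=
  if i is i'.+1 then
    fun j => (st i' j (scan i' (gridV i') j) (gridV i' j)).2
  else v0.

Definition gridH (i : nat) : nat -> nat := scan i (gridV i).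

Lemma gridE i j :
  (gridH i j.+1, gridV i.+1 j) = st i j (gridH i j) (gridV i j).
Proof. by rewrite /gridH /=; case: st. Qed.

End Grid.

(** Boundary and rule are assumed only inside the N by N square, so that transposed and rotated
    grids can be compared as well. *)
Lemma grid_unique N (st : nat -> nat -> nat -> nat -> nat * nat)
    (H V H' V' : nat -> nat -> nat) :
    (forall i, i < N -> H i 0 = H' i 0) -> (forall j, j < N -> V 0 j = V' 0 j) ->
    (forall i j, i < N -> j < N -> (H i j.+1, V i.+1 j) = st i j (H i j) (V i j)) ->
    (forall i j, i < N -> j < N ->
       (H' i j.+1, V' i.+1 j) = st i j (H' i j) (V' i j)) ->
  forall i j, (i < N -> j <= N -> H i j = H' i j) /\
              (i <= N -> j < N -> V i j = V' i j).
Proof.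
move=> eH eV gH gH'.
have step i j : i < N -> j < N -> H i j = H' i j -> V i j = V' i j ->
    H i j.+1 = H' i j.+1 /\ V i.+1 j = V' i.+1 j.
  move=> iN jN e1 e2; have := gH' i j iN jN.
  by rewrite -e1 -e2 -gH // => -[-> ->].
elim=> [|i IHi].
  elim=> [|j [IHj IHj']]; first by split=> [N0 _|_ N0]; [apply: eH | apply: eV].
  split=> [N0 jN|_ jN]; last exact: eV.
  by have [] := step 0 j N0 jN (IHj N0 (ltnW jN)) (eV _ jN).
elim=> [|j [IHj IHj']].
  split=> [iN _|iN N0]; first exact: eH.
  by case: (IHi 0) => a b; case: (step i 0 iN N0 (a iN isT) (b (ltnW iN) N0)).
split=> [iN jN|iN jN].
  by case: (step i.+1 j iN jN (IHj iN (ltnW jN)) (IHj' (ltnW iN) jN)).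
case: (IHi j.+1) => a b.
by case: (step i j.+1 iN jN (a iN (ltnW jN)) (b (ltnW iN) jN)).
Qed.

Lemma count_mem_rcons (w : seq nat) x l :
  count_mem l (rcons w x) = count_mem l w + (x == l).
Proof. by rewrite -cats1 count_cat /= addn0. Qed.

Definition lattice (w : seq nat) : Prop := forall i l, 0 < l ->
  count_mem l.+1 (take i w) <= count_mem l (take i w).

Lemma take_mkseq (T : Type) (f : nat -> T) i n :
  i <= n -> take i (mkseq f n) = mkseq f i.
Proof. by move=> le_in; rewrite /mkseq -map_take take_iota (minn_idPl le_in). Qed.

Lemma lattice_mkseq (f : nat -> nat) n : lattice (mkseq f n) <->
  forall i l, i <= n -> 0 < l ->
    count_mem l.+1 (mkseq f i) <= count_mem l (mkseq f i).
Proof.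
split=> [lat i l le_in l0|lat i l l0].
  by have := lat i l l0; rewrite take_mkseq.
have [le_in|/ltnW lt_ni] := leqP i n; first by rewrite take_mkseq ?lat.
by rewrite take_oversize ?size_mkseq ?lat.
Qed.

Lemma lattice_rcons w x : lattice (rcons w x) <->
  lattice w /\ (1 < x -> count_mem x w < count_mem x.-1 w).
Proof.
split=> [lat|[lat hx] i l l0].
  split=> [i l l0|x1].
    have [le_iw|lt_wi] := leqP i (size w).
      by have := lat i l l0; rewrite -cats1 takel_cat.
    by have := lat (size w) l l0; rewrite -cats1 take_size_cat // take_oversize ?(ltnW lt_wi).
  have := lat (size w).+1 x.-1; rewrite take_oversize ?size_rcons //.
  rewrite !count_mem_rcons prednK ?(ltnW x1) //= eqxx.
  by case: eqP; lia.
have [le_iw|lt_wi] := leqP i (size w).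
  by rewrite -cats1 takel_cat //; apply: lat.
rewrite take_oversize ?size_rcons // !count_mem_rcons.
have := lat (size w) l l0; rewrite take_size /=.
by case: eqP => [e|_]; case: eqP => [e'|_]; move: hx; rewrite ?e /=; lia.
Qed.

(** The last clause makes every square reversible through [crossK], and stands in for [M] having at
    most one point per row and column. *)
Definition is_grid (N : nat) (M : nat -> nat -> bool) (H V : nat -> nat -> nat) :=
  [/\ forall i, i < N -> H i 0 = 0, forall j, j < N -> V 0 j = 0,
      forall i j, i < N -> j < N ->
        (H i j.+1, V i.+1 j) = cross (H i j) (V i j) (M i j)
    & forall i j, i < N -> j < N -> M i j -> H i j = 0 /\ V i j = 0].

Lemma is_grid_tr N M H V : is_grid N M H V ->
  is_grid N (fun j i => M i j) (fun j i => V i j) (fun j i => H i j).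
Proof.
case=> H0 V0 E Z; split=> // [j i jN iN|j i jN iN /(Z i j iN jN)[]//].
by rewrite crossC -E.
Qed.

Section IsGrid.
Variables (N : nat) (M : nat -> nat -> bool) (H V : nat -> nat -> nat).
Hypothesis gridP : is_grid N M H V.

Lemma grid_uncross i j : i < N -> j < N ->
  (H i j, V i j) = uncross (H i j.+1) (V i.+1 j) /\
  M i j = crossing (H i j.+1) (V i.+1 j).
Proof.
case: gridP => _ _ E Z iN jN.
have := crossK (Z i j iN jN); rewrite -E //.
by case=> -> ->.
Qed.

(** The counts of positive labels in [mkseq (H^~ j) i] are the row lengths of the shape at the
    corner (i, j); [V i j] names the row in which the shape at (i, j + 1) has one more cell. *)
Lemma grid_content i j l : i <= N -> j < N -> 0 < l ->
  count_mem l (mkseq (H^~ j.+1) i) = count_mem l (mkseq (H^~ j) i) + (V i j == l).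
Proof.
case: gridP => _ V0 E _ + jN l0; elim: i => [|i IH] iN.
  by rewrite V0 // eq_sym (gtn_eqF l0).
rewrite !mkseqS !count_mem_rcons IH ?(ltnW iN) //=.
have := E i j iN jN; rewrite /cross; case: eqP => [->|_] [-> ->]; lia.
Qed.

Lemma grid_row_lattice j : j <= N -> lattice (mkseq (H^~ j) N).
Proof.
case: gridP => H0 V0 E _; elim: j => [|j IH] jN.
  apply/lattice_mkseq => i l iN l0.
  have -> : mkseq (H^~ 0) i = nseq i 0.
    apply: (@eq_from_nth _ 0) => [|k]; rewrite ?size_mkseq ?size_nseq // => ki.
    by rewrite nth_mkseq // nth_nseq ki H0 //; apply: leq_trans iN.
  by rewrite !count_nseq.
have lat := (lattice_mkseq _ _).1 (IH (ltnW jN)).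
(* The cell recorded by [V i j] can be added to the shape at (i, j): the row above it is strictly
   longer. *)
have corner i : i <= N -> 1 < V i j ->
    count_mem (V i j) (mkseq (H^~ j) i) < count_mem (V i j).-1 (mkseq (H^~ j) i).
  elim: i => [|i IHi] iN; first by rewrite V0.
  have := lat i (V i j) (ltnW iN); move: (IHi (ltnW iN)).
  rewrite !mkseqS !count_mem_rcons /=; have := E i j iN jN.
  rewrite /cross; case: (eqVneq (H i j)) => [->|ne] [_ ->].
    case: (eqVneq (V i j) 0) => [->|]; first by case: (M i j).
    by rewrite /= eqxx (ltn_eqF (ltnSn _)); lia.
  by rewrite (negPf ne); lia.
apply/lattice_mkseq => i l iN l0; rewrite !grid_content //.
have := lat i l iN l0; have := corner i iN.
by case: (eqVneq (V i j) l.+1) => [->|_] /=; case: eqP; lia.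
Qed.

(** Both sides are row lengths of the shape at the corner (N, j), reached along the line at height j
    or up the right edge. *)
Lemma grid_content_eq j l : j <= N -> 0 < l ->
  count_mem l (mkseq (H^~ j) N) = count_mem l (mkseq (V N) j).
Proof.
case: gridP => H0 _ _ _ + l0; elim: j => [|j IH] jN.
  rewrite /=; apply/count_memPn/mapP => -[i]; rewrite mem_iota /= => iN.
  by rewrite H0 //; lia.
by rewrite grid_content // IH ?(ltnW jN) // mkseqS count_mem_rcons /= addnC.
Qed.

(** To the right of a point the vertical label is kept or raised, so it never returns to 0. This
    excludes a second point in the same row. *)
Lemma grid_V_gt0 i j : i < N -> j < N -> M i j ->
  forall i', i < i' <= N -> 0 < V i' j.
Proof.
case: gridP => _ _ E Z iN jN Mij; elim=> // i' IH /andP[].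
rewrite ltnS leq_eqVlt => /orP[/eqP <-|lt_ii'] i'N.
  have [h0 v0] := Z i j iN jN Mij.
  by have := E i j iN jN; rewrite h0 v0 Mij => -[_ ->].
have := IH; rewrite lt_ii' (ltnW i'N) => /(_ isT); have := E i' j i'N jN.
by rewrite /cross; case: eqP => [<-|_] [_ ->] //; case: eqP; lia.
Qed.

Lemma grid_M_inj i i' j : i < N -> i' < N -> j < N -> M i j -> M i' j -> i = i'.
Proof.
move=> iN i'N jN Mij Mi'j; case: gridP => _ _ _ Z.
have [_ Vi] := Z i j iN jN Mij; have [_ Vi'] := Z i' j i'N jN Mi'j.
have [lt|lt|//] := ltngtP i i'.
  by have := grid_V_gt0 iN jN Mij (i' := i'); rewrite lt Vi' (ltnW i'N) => /(_ isT).
by have := grid_V_gt0 i'N jN Mi'j (i' := i); rewrite lt Vi (ltnW iN) => /(_ isT).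
Qed.

(** A vertical label starts at 0 on the left edge and can leave 0 only at a point. *)
Lemma grid_M_ex j : j < N -> 0 < V N j -> exists2 i, i < N & M i j.
Proof.
move=> jN; case: gridP => _ V0 E _.
suff: forall i, i <= N -> 0 < V i j -> exists2 i, i < N & M i j.
  by apply.
elim=> [|i IH] iN; first by rewrite V0.
have [V0i|] := eqVneq (V i j) 0; last by rewrite -lt0n => /(IH (ltnW iN)).
have := E i j iN jN; rewrite V0i /cross.
case: (eqVneq (H i j) 0) => [_|_] [_ ->] //=.
by case Mij: (M i j) => // _; exists i.
Qed.

End IsGrid.

(** * Reconstruction of a grid from its top and right edges *)

Section Backward.
Variables (N : nat) (q p : nat -> nat).
Hypotheses (q_gt0 : forall i, i < N -> 0 < q i).
Hypotheses (p_gt0 : forall j, j < N -> 0 < p j).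
Hypotheses (q_lat : lattice (mkseq q N)) (p_lat : lattice (mkseq p N)).
Hypothesis qp_content : forall l, 0 < l ->
  count_mem l (mkseq q N) = count_mem l (mkseq p N).

(** The forward construction is run with [uncross] after a half turn: indices of squares become N -
    1 - i, indices of grid lines N - j. *)
Let st (_ _ : nat) := uncross.
Let H i j := gridH st (fun i => q (N.-1 - i)) (fun j => p (N.-1 - j))
  (N.-1 - i) (N - j).
Let V i j := gridV st (fun i => q (N.-1 - i)) (fun j => p (N.-1 - j))
  (N - i) (N.-1 - j).

Let HN i : i < N -> H i N = q i.
Proof. by rewrite /H subnn /= => iN; congr q; lia. Qed.

Let VN j : j < N -> V N j = p j.
Proof. by rewrite /V subnn /= => iN; congr p; lia. Qed.

Let HVE i j : i < N -> j < N -> (H i j, V i j) = uncross (H i j.+1) (V i.+1 j).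
Proof.
move=> iN jN; rewrite /H /V.
have -> : N - j = (N.-1 - j).+1 by lia.
have -> : N - i = (N.-1 - i).+1 by lia.
by rewrite gridE /st; congr (uncross (gridH _ _ _ _ _) (gridV _ _ _ _ _)); lia.
Qed.

(** Going down one row removes at most one cell from each shape at height j + 1. By [corner],
    carried from right to left, that cell is always removable, so the shapes at height j are again
    partitions. *)
Let row_step j : j < N -> lattice (mkseq (H^~ j.+1) N) ->
    count_mem (p j).+1 (mkseq (H^~ j.+1) N) < count_mem (p j) (mkseq (H^~ j.+1) N) ->
  [/\ V 0 j = 0, lattice (mkseq (H^~ j) N)
    & forall l, 0 < l -> count_mem l (mkseq (H^~ j.+1) N) =
                         count_mem l (mkseq (H^~ j) N) + (p j == l)].
Proof.
move=> jN /lattice_mkseq lat cornerN.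
have corner k : k <= N -> 0 < V (N - k) j ->
    count_mem (V (N - k) j).+1 (mkseq (H^~ j.+1) (N - k)) <
    count_mem (V (N - k) j) (mkseq (H^~ j.+1) (N - k)).
  elim: k => [|k IHk] kN; first by rewrite subn0 VN.
  have := IHk (ltnW kN); have -> : N - k = (N - k.+1).+1 by lia.
  have iN : N - k.+1 < N by lia.
  move: (N - k.+1) iN => i iN; have := HVE iN jN; rewrite /uncross.
  have := lat i.+1 (V i j) iN.
  rewrite !mkseqS !count_mem_rcons.
  case: (eqVneq (H i j.+1) (V i.+1 j)) => [->|ne] + [_ e].
    move: e; case: (V i.+1 j) => [|v] -> /=; first by lia.
    by rewrite eqxx (gtn_eqF (ltnSn v)); lia.
  by rewrite e (negPf ne); lia.
(* At the left edge the shape is empty and has no removable cell. *)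
have V0 : V 0 j = 0.
  have := corner N (leqnn N); rewrite subnn /=.
  by case: (V 0 j) => // v /(_ isT).
have content i l : i <= N -> 0 < l -> count_mem l (mkseq (H^~ j.+1) i) =
    count_mem l (mkseq (H^~ j) i) + (V i j == l).
  move=> + l0; elim: i => [|i IH] iN; first by rewrite V0 /= eq_sym (gtn_eqF l0).
  rewrite !mkseqS !count_mem_rcons IH ?(ltnW iN) //.
  have := HVE iN jN; rewrite /uncross.
  by case: (eqVneq (H i j.+1) (V i.+1 j)) => [->|ne] [-> ->]; lia.
split=> // [|l l0]; last by rewrite content // VN.
apply/lattice_mkseq => i l iN l0; have := lat i l iN l0.
rewrite !content //.
have := corner (N - i) (leq_subr _ _); rewrite subKn //.
case: (eqVneq (V i j) l) => [Vl|_ _]; last by lia.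
by rewrite Vl => /(_ l0); rewrite !content // Vl; lia.
Qed.

(** Descent from the top edge: the lattice property of [p] supplies the removable cell that
    [row_step] asks for at each height. *)
Let row_lattice k : k <= N -> lattice (mkseq (H^~ (N - k)) N) /\
  forall l, 0 < l -> count_mem l (mkseq (H^~ (N - k)) N) =
                     count_mem l (mkseq p (N - k)).
Proof.
elim: k => [|k IH] kN.
  rewrite subn0; suff -> : mkseq (H^~ N) N = mkseq q N by [].
  apply/eq_in_map => i; rewrite mem_iota => /andP[_ iN]; exact: HN.
have [] := IH (ltnW kN); have -> : N - k = (N - k.+1).+1 by lia.
have jN : N - k.+1 < N by lia.
move: (N - k.+1) jN => j jN lat cont.
have p0 := p_gt0 jN.
have [||_ lat' cont'] := row_step jN => //.
  rewrite !cont // mkseqS !count_mem_rcons eqxx (ltn_eqF (ltnSn _)).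
  by have := (lattice_mkseq _ _).1 p_lat j (p j) (ltnW jN) p0; lia.
split=> // l l0; have := cont l l0; rewrite cont' // mkseqS count_mem_rcons; lia.
Qed.

Lemma grid_backward : exists H V, [/\
    is_grid N (fun i j => crossing (H i j.+1) (V i.+1 j)) H V,
    forall i, i < N -> H i N = q i & forall j, j < N -> V N j = p j].
Proof.
exists H, V; split=> //; split=> [i iN|j jN|i j iN jN|i j iN jN].
(* At height 0 the content is that of the empty word, so no positive label remains. *)
- have [_ cont] := row_lattice (leqnn N); rewrite subnn in cont.
  have [//|] := posnP (H i 0) => H0.
  have : count_mem (H i 0) (mkseq (H^~ 0) N) = 0 by rewrite cont.
  move/count_memPn/negP; case; apply/mapP.
  by exists i => //; rewrite mem_iota.
- have [lat cont] := row_lattice (k := N - j.+1) (leq_subr _ _).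
  rewrite subKn // in lat cont.
  have [] // := row_step jN lat.
  rewrite !cont ?p_gt0 // mkseqS !count_mem_rcons eqxx (ltn_eqF (ltnSn _)).
  have := (lattice_mkseq _ _).1 p_lat j (p j) (ltnW jN) (p_gt0 jN); lia.
- by rewrite -[LHS](uncrossK) -HVE.
- move=> /andP[/eqP h1 /eqP v1].
  by have := HVE iN jN; rewrite h1 v1 => -[-> ->].
Qed.

End Backward.

Lemma eq_is_grid N M M' H V : (forall i j, i < N -> j < N -> M i j = M' i j) ->
  is_grid N M H V -> is_grid N M' H V.
Proof.
move=> eM [H0 V0 E Z]; split=> // i j iN jN; first by rewrite -eM // E.
by rewrite -eM //; apply: Z.
Qed.

(** After a half turn, both grids obey [uncross] with the same boundary, so [grid_unique] identifies
    them; [crossing] then recovers the points. *)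
Lemma is_grid_inj N M M' H V H' V' : is_grid N M H V -> is_grid N M' H' V' ->
    (forall i, i < N -> H i N = H' i N) -> (forall j, j < N -> V N j = V' N j) ->
  forall i j, i < N -> j < N -> M i j = M' i j.
Proof.
move=> G G' eH eV.
pose rH (H : nat -> nat -> nat) i j := H (N.-1 - i) (N - j).
pose rV (V : nat -> nat -> nat) i j := V (N - i) (N.-1 - j).
have rE M1 H1 V1 : is_grid N M1 H1 V1 -> forall i j, i < N -> j < N ->
    (rH H1 i j.+1, rV V1 i.+1 j) = uncross (rH H1 i j) (rV V1 i j).
  move=> G1 i j iN jN; rewrite /rH /rV.
  have [iN' jN'] : N.-1 - i < N /\ N.-1 - j < N by lia.
  have -> : N - j = (N.-1 - j).+1 by lia.
  have -> : N - i = (N.-1 - i).+1 by lia.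
  by rewrite -(grid_uncross G1 iN' jN').1; congr (H1 _ _, V1 _ _); lia.
have U : forall i j, (i < N -> j <= N -> rH H i j = rH H' i j) /\
                     (i <= N -> j < N -> rV V i j = rV V' i j).
  apply: (grid_unique (st := fun _ _ => uncross)); rewrite /rH /rV.
  - by move=> i iN; rewrite subn0 eH //; lia.
  - by move=> j jN; rewrite subn0 eV //; lia.
  - exact: rE G.
  - exact: rE G'.
move=> i j iN jN; rewrite (grid_uncross G iN jN).2 (grid_uncross G' iN jN).2.
have [[e _] [_ e']] := (U (N.-1 - i) (N - j.+1), U (N - i.+1) (N.-1 - j)).
move: e e'; rewrite /rH /rV.
have [-> ->] : N.-1 - (N.-1 - i) = i /\ N.-1 - (N.-1 - j) = j by lia.
rewrite !subKn // => eHij eVij.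
by rewrite eHij ?eVij ?leq_subr //; lia.
Qed.

(** * The growth grid of a permutation and its pair of lattice words *)

Section PermGrid.
Variable N : nat.
Implicit Types p : 'S_N.

(** The permutation matrix on natural number indices. Entries of [one_line] start at 1, so the
    default 0 gives no point outside the square. *)
Definition pmat p i j : bool := nth 0 (one_line p) i == j.+1.

Lemma pmatE p (i j : 'I_N) : pmat p i j = (p i == j).
Proof.
rewrite /pmat /one_line (nth_map i) ?size_enum_ord // nth_ord_enum.
by rewrite eqSS.
Qed.

Lemma pmatV p i j : i < N -> j < N -> pmat p^-1%g j i = pmat p i j.
Proof.
move=> iN jN; rewrite -[i]/(val (Ordinal iN)) -[j]/(val (Ordinal jN)) !pmatE.
by rewrite -(inj_eq (@perm_inj _ p)) permKV eq_sym.
Qed.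

Definition pst p i j h v := cross h v (pmat p i j).
Definition pH p := gridH (pst p) (fun=> 0) (fun=> 0).
Definition pV p := gridV (pst p) (fun=> 0) (fun=> 0).

Lemma pgridE p i j :
  (pH p i j.+1, pV p i.+1 j) = cross (pH p i j) (pV p i j) (pmat p i j).
Proof. exact: gridE. Qed.

(** The local rule is symmetric and inversion transposes the matrix, so the whole grid is
    transposed. *)
Lemma pgridV p i j : (i < N -> j <= N -> pH p^-1%g i j = pV p j i) /\
                     (i <= N -> j < N -> pV p^-1%g i j = pH p j i).
Proof.
move: i j; apply: (grid_unique (st := pst p^-1%g)) => // i j iN jN.
  exact: pgridE.
by rewrite /pst pmatV // crossC -pgridE.
Qed.

Lemma pmat_inj2 p i j j' : i < N -> j < N -> j' < N ->
  pmat p i j -> pmat p i j' -> j = j'.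
Proof. by move=> iN jN j'N; rewrite /pmat => /eqP -> /eqP[]. Qed.

Lemma pV_eq0 p i j : i < N -> j < N -> pmat p i j ->
  forall i', i' <= i -> pV p i' j = 0.
Proof.
move=> iN jN Mij; elim=> // i' IH lt_i'i.
have := pgridE p i' j; rewrite (IH (ltnW lt_i'i)).
suff -> : pmat p i' j = false by rewrite /cross; case: (pH p i' j) => [|h] /= [].
apply/negP; rewrite -pmatV ?(ltn_trans lt_i'i) // => M'.
move: Mij; rewrite -pmatV // => Mij.
have := pmat_inj2 jN iN (ltn_trans lt_i'i iN) Mij M'; lia.
Qed.

Lemma pgrid_is_grid p : is_grid N (pmat p) (pH p) (pV p).
Proof.
split=> // [i j iN jN|i j iN jN Mij]; first exact: pgridE.
split; last exact: pV_eq0 Mij _ _.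
have [e _] := pgridV p^-1%g i j; rewrite invgK in e.
by rewrite e ?(ltnW jN) //; apply: (pV_eq0 jN iN) => //; rewrite pmatV.
Qed.

(** The top edge of the grid. It encodes the recording tableau: its letters are the rows, counted
    from 1, of the successive new cells. The right edge is the same word for the inverse. *)
Definition qword p : seq nat := mkseq (fun i => pH p i N) N.

Lemma qwordV p : qword p^-1%g = mkseq (pV p N) N.
Proof.
apply/eq_in_map => i; rewrite mem_iota => /andP[_ iN].
by case: (pgridV p i N) => ->.
Qed.

Lemma qword_lattice p : lattice (qword p).
Proof. exact: grid_row_lattice (pgrid_is_grid p) _ _. Qed.

Lemma qword_content p l : 0 < l ->
  count_mem l (qword p^-1%g) = count_mem l (qword p).
Proof.
by move=> l0; rewrite qwordV /qword (grid_content_eq (pgrid_is_grid p)).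
Qed.

Lemma qword_gt0 p : 0 \notin qword p.
Proof.
suff {p} hV p : 0 \notin qword p^-1%g by rewrite -[p]invgK.
rewrite qwordV; apply/mapP => -[j]; rewrite mem_iota => /andP[_ jN] V0.
pose i := (p^-1%g (Ordinal jN)).
suff : 0 < pV p N j by rewrite -V0.
apply: (grid_V_gt0 (pgrid_is_grid p) (ltn_ord i) jN) => //; last by rewrite ltn_ord /=.
by rewrite -[j]/(val (Ordinal jN)) pmatE permKV.
Qed.

Lemma qword_inj p p' :
  qword p = qword p' -> qword p^-1%g = qword p'^-1%g -> p = p'.
Proof.
rewrite !qwordV => /eq_in_map eH /eq_in_map eV; apply/permP => i.
apply/eqP; rewrite -pmatE (is_grid_inj (pgrid_is_grid p) (pgrid_is_grid p')) //.
- by rewrite pmatE.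
- by move=> k kN; apply: eH; rewrite mem_iota.
- by move=> k kN; apply: eV; rewrite mem_iota.
Qed.

Lemma qword_surj u v : size u = N -> size v = N -> 0 \notin u -> 0 \notin v ->
    lattice u -> lattice v ->
    (forall l, 0 < l -> count_mem l u = count_mem l v) ->
  exists p, qword p = u /\ qword p^-1%g = v.
Proof.
move=> su sv u0 v0 lu lv uv.
have [Eu Ev] : mkseq (nth 0 u) N = u /\ mkseq (nth 0 v) N = v.
  by split; [rewrite -su mkseq_nth | rewrite -sv mkseq_nth].
have gt0 w k : size w = N -> 0 \notin w -> k < N -> 0 < nth 0 w k.
  move=> sw w0 kN; rewrite lt0n; apply: contraNneq w0 => <-.
  by rewrite mem_nth ?sw.
have [] := @grid_backward N (nth 0 u) (nth 0 v); rewrite ?Eu ?Ev //.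
- by move=> i iN; apply: gt0.
move=> H [V [G HN VN]].
set M := (fun i j => _) in G.
(* The label of row j on the right edge is positive, so the row holds a point. The map [g] from
   values to positions is then the inverse of the permutation sought. *)
have exM (j : 'I_N) : {i : 'I_N | M i j}.
  apply: sigW; have [|i iN Mij] := grid_M_ex G (ltn_ord j).
    by rewrite VN //; apply: gt0.
  by exists (Ordinal iN).
pose g j := sval (exM j).
have Mg j : M (g j) j by rewrite /g; case: (exM j).
have g_inj : injective g.
  move=> j j' e; apply: val_inj.
  apply: (grid_M_inj (is_grid_tr G) (ltn_ord j) (ltn_ord j') (ltn_ord (g j))).
    exact: Mg.
  by rewrite e; apply: Mg.
pose p := ((perm g_inj)^-1)%g.
have pM i j : i < N -> j < N -> M i j = pmat p i j.
  move=> iN jN; rewrite -[i]/(val (Ordinal iN)) -[j]/(val (Ordinal jN)) pmatE.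
  move: (Ordinal iN) (Ordinal jN) => {iN jN} {}i {}j.
  rewrite -(inj_eq (@perm_inj _ (perm g_inj))) permKV permE.
  apply/idP/eqP => [Mij|->]; last exact: Mg.
  by apply: val_inj; apply: (grid_M_inj G (ltn_ord i) (ltn_ord (g j)) (ltn_ord j)) (Mg j).
have [H0 V0 E _] := eq_is_grid pM G; have [H0' V0' E' _] := pgrid_is_grid p.
(* The grid rebuilt from [u] and [v] has the points of [p] and a zero boundary, so it is the grid of
   [p]. *)
have U : forall i j, (i < N -> j <= N -> pH p i j = H i j) /\
                     (i <= N -> j < N -> pV p i j = V i j).
  apply: (grid_unique (st := pst p)) E' E => [i iN|j jN].
    by rewrite H0.
  by rewrite V0.
exists p; rewrite qwordV -Eu -Ev; split; apply/eq_in_map => i.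
  by rewrite mem_iota => /andP[_ iN]; rewrite (U i N).1 ?HN.
by rewrite mem_iota => /andP[_ iN]; rewrite (U N i).2 ?VN.
Qed.

End PermGrid.

(** * Row insertion and growth grids *)

(** Rows are described through membership, the form in which the labels of a grid record them. *)
Lemma row_insertP (r : seq nat) x : sorted ltn r -> x \notin r ->
  [/\ sorted ltn (row_insert r x).1,
      forall z, (z \in (row_insert r x).1) =
                (z == x) || (z \in r) && (Some z != (row_insert r x).2)
    & match (row_insert r x).2 with
      | None => forall z, z \in r -> z < x
      | Some y => [/\ y \in r, x < y & forall z, z \in r -> x < z -> y <= z]
      end].
Proof.
elim: r => [|y r IH] /=; first by split=> // z; rewrite orbF.
rewrite (path_sortedE ltn_trans) => /andP[/allP y_r sr].
rewrite inE negb_or => /andP[nxy nxr].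
have [lt_xy|le_yx] := ltnP x y => /=.
  split=> [|z|]; rewrite ?(path_sortedE ltn_trans) /=.
  - rewrite sr andbT; apply/allP => z /y_r; exact: ltn_trans.
  - rewrite !inE (inj_eq Some_inj); case: (eqVneq z x) => //= _.
    case: eqVneq => //= [->|_]; last by rewrite andbT.
    by apply/negP => /y_r /=; rewrite ltnn.
  - split=> // [|z]; first exact: mem_head.
    by rewrite inE => /predU1P[->//|/y_r/ltnW].
case: row_insert (IH sr nxr) => r' b /= [sr' mem_r' hb].
have lt_yx : y < x by rewrite ltn_neqAle eq_sym nxy.
split=> [|z|]; rewrite ?(path_sortedE ltn_trans) /=.
- rewrite sr' andbT; apply/allP => z; rewrite mem_r'.
  by case/orP=> [/eqP->|/andP[/y_r]].
- rewrite !inE mem_r'; case: (eqVneq z y) => [->|_] //=.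
  rewrite [RHS](_ : _ = true) //; apply/orP; right.
  case: b hb {mem_r'} => // y' [y'r _ _]; rewrite (inj_eq Some_inj).
  by rewrite (ltn_eqF (y_r _ y'r)).
- case: b hb {mem_r'} => [y' [y'r lt_xy' y'min]|hb].
    split=> // [|z]; first by rewrite inE y'r orbT.
    by rewrite inE => /predU1P[->|/y'min//]; lia.
  by move=> z /predU1P[->|/hb].
Qed.

Section Bumping.
Variables (N : nat) (h v v' : nat -> nat).

Lemma carry_mono a b : (forall j, a <= j < b ->
      (h j.+1, v' j) = cross (h j) (v j) false) -> 0 < h a ->
  forall j, a <= j <= b -> h a <= h j.
Proof.
move=> step ha; elim=> [|j IH] jab; first by have -> : a = 0 by lia.
have [->//|ne] := eqVneq a j.+1.
have [lt_ja [jab' jab'']] : a <= j /\ a <= j < b /\ a <= j <= b by lia.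
have := IH jab''; have := step j jab'; rewrite /cross.
by case: (h j =P v j) => _ [-> _] //; case: (h j) => /=; lia.
Qed.

(** A carry that meets no label equal to itself passes unchanged; a zero carry also passes a zero
    label, since these squares hold no point. *)
Lemma carry_const a b : (forall j, a <= j < b ->
      (h j.+1, v' j) = cross (h j) (v j) false) ->
    (forall j, a <= j < b -> v j != h a \/ h a = 0) ->
  (forall j, a <= j <= b -> h j = h a) /\ (forall j, a <= j < b -> v' j = v j).
Proof.
move=> step ne.
have hE : forall j, a <= j <= b -> h j = h a.
  elim=> [|j IH] jab; first by congr h; lia.
  have [<-//|lt] := eqVneq j.+1 a.
  have jab' : a <= j < b by lia.
  have := step j jab'; rewrite /cross IH; last by lia.
  case: eqP => [e|_] [-> _] //; case: (ne j jab') => [|->//].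
  by rewrite e eqxx.
split=> // j jab; have := step j jab; rewrite /cross (hE j); last by lia.
case: eqP => [e|_] [_ ->] //; case: (ne j jab) => [|h0].
  by rewrite e eqxx.
by rewrite -e h0.
Qed.

(* The carry [h] of the scan is the (shifted) index of the row into which the
   last bumped entry goes: [z.+1] is bumped from row [r] exactly when the label
   [r.+1] of [z] equals the carry. *)
Lemma tab_insert_scan (T : tableau) r y : y < N -> all (sorted ltn) T ->
    (forall k z, z \in nth [::] T k -> 0 < z <= N) ->
    (forall k, y.+1 \notin nth [::] T k) -> h y.+1 = r.+1 ->
    (forall j, y < j < N -> (h j.+1, v' j) = cross (h j) (v j) false) ->
    (forall k j, y < j < N -> (j.+1 \in nth [::] T k) = (v j == (r + k).+1)) ->
  let T' := (tab_insert T y.+1).1 in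
  [/\ all (sorted ltn) T', h N = (r + (tab_insert T y.+1).2).+1,
      forall k z, z \in nth [::] T' k -> 0 < z <= N
    & forall k j, j < N -> (j.+1 \in nth [::] T' k) =
        if j < y then j.+1 \in nth [::] T k
        else if j == y then k == 0 else v' j == (r + k).+1].
Proof.
elim: T r y => [|s T IH] r y yN.
  move=> _ _ _ hy step mem.
  have [|hE vE] := carry_const (a := y.+1) (b := N) step.
    by move=> j jab; left; rewrite hy -[r]addn0 -mem ?nth_nil.
  split=> //=; first by rewrite hE ?hy ?addn0 //; lia.
    move=> [|k] z /=; last by rewrite nth_nil.
    by rewrite inE => /eqP ->.
  move=> k j jN; have [lt|lt|->] := ltngtP j y.
  - by case: k => [|k] /=; rewrite ?nth_nil ?in_nil ?inE //; lia.
  - rewrite vE ?lt // -mem ?lt // nth_nil.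
    by case: k => [|k] /=; rewrite ?nth_nil ?in_nil ?inE //; lia.
  - by case: k => [|k] /=; rewrite ?nth_nil //= inE eqxx.
move=> /= /andP[ss sT] bd fresh hy step mem.
have := row_insertP ss (fresh 0) => /=.
case: row_insert => s' [z1|] /= [ss' mem_s' hb]; last first.
  have [|hE vE] := carry_const (a := y.+1) (b := N) step.
    move=> j jab; left; rewrite hy -[r]addn0 -(mem 0) //=.
    by apply/negP => /hb; lia.
  split; rewrite /= ?ss' ?sT //; first by rewrite hE ?hy ?addn0 //; lia.
    move=> [|k] z /=; last by apply: (bd k.+1).
    by rewrite mem_s' => /orP[/eqP->//|/andP[/(bd 0)]].
  move=> k j jN; have [lt|lt|->] := ltngtP j y.
  - case: k => [|k] //=; rewrite mem_s' andbT eqSS.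
    by rewrite (ltn_eqF lt).
  - rewrite vE ?lt // -mem ?lt //; case: k => [|k] //=.
    by rewrite mem_s' andbT eqSS (gtn_eqF lt).
  - case: k => [|k] //=; first by rewrite mem_s' eqxx.
    by apply/negP; apply/negP/(fresh k.+1).
case: hb => z1s lt_yz z1min; have z1N := bd 0 _ z1s.
case: z1 z1N z1s lt_yz z1min mem_s' => // z /andP[_ zN] zs.
rewrite ltnS => lt_yz z1min mem_s'.
have vz : v z = r.+1.
  by have := mem 0 z; rewrite /= zs lt_yz zN addn0 => /(_ isT)/esym/eqP.
(* The bumped entry is the least one of the row above the inserted letter, so the carry meets no
   entry of this row before it. *)
have [||hE vE] := carry_const (a := y.+1) (b := z).
- by move=> j jab; apply: step; lia.
- move=> j jab; left; rewrite hy -[r]addn0 -(mem 0) /=; last by lia.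
  by apply/negP => /z1min; lia.
have hz : h z = r.+1 by rewrite hE ?hy //; lia.
have := step z; rewrite lt_yz zN hz vz /cross eqxx /= => /(_ isT)[hz1 v'z].
have [|||||] := IH r.+1 z zN sT.
- by move=> k; apply: (bd k.+1).
- by move=> k; rewrite (mem k.+1) ?vz ?lt_yz //; lia.
- exact: hz1.
- by move=> j /andP[lt_zj jN]; apply: step; rewrite jN (ltn_trans lt_yz).
- move=> k j /andP[lt_zj jN]; rewrite (mem k.+1) ?addnS ?addSn //.
  by rewrite jN (ltn_trans lt_yz).
case: tab_insert => T'' i /= sT'' hN bd'' mem''; split.
- by rewrite ss'.
- by rewrite hN addnS addSn.
- move=> [|k] x /=; last exact: bd''.
  by rewrite mem_s' => /orP[/eqP->//|/andP[/(bd 0)]].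
move=> [|k] j jN /=.
  rewrite mem_s' eqSS (inj_eq Some_inj) eqSS.
  have [lt|lt|->] //= := ltngtP j y.
    by rewrite (ltn_eqF (ltn_trans lt lt_yz)) andbT.
  rewrite (mem 0) ?lt //= addn0.
  have [lt'|lt'|->] := ltngtP j z; last by rewrite andbF v'z; lia.
    by rewrite andbT vE ?lt.
  rewrite andbT; have := step j; rewrite lt jN => /(_ isT).
  (* Past the bumped entry the carry exceeds r + 1, so the other labels of row r stay as they
     are. *)
  have := @carry_mono z.+1 N; rewrite hz1 => /(_ _ _ j) hj.
  have {}hj : r.+1 < h j.
    by apply: hj => // [k kN|]; [apply: step; lia | lia].
  rewrite /cross; case: (eqVneq (h j) (v j)) => [<-|_] [_ ->] //.
  by move: hj; case: (h j) => /=; lia.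
have [lt|lt|->] /= := ltngtP j y.
- by rewrite mem'' // (ltn_trans lt lt_yz).
- rewrite mem'' //; have [lt'|lt'|->] := ltngtP j z.
  + by rewrite (mem k.+1) ?lt // vE ?lt.
  + by rewrite addnS addSn.
  + by rewrite v'z; lia.
- by rewrite mem'' // lt_yz; apply/negbTE/(fresh k.+1).

Qed.

End Bumping.

Section PermTableau.
Variables (N : nat) (p : 'S_N).

Definition ptab i : tableau :=
  foldl (fun T x => (tab_insert T x).1) [::] (take i (one_line p)).

Lemma size_one_line : size (one_line p) = N.
Proof. by rewrite size_map size_enum_ord. Qed.

Lemma nth_one_line (i : 'I_N) : nth 0 (one_line p) i = (p i).+1.
Proof. by rewrite (nth_map i) ?size_enum_ord // nth_ord_enum. Qed.

Lemma ptabS i : i < N ->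
  ptab i.+1 = (tab_insert (ptab i) (nth 0 (one_line p) i)).1.
Proof.
by move=> iN; rewrite /ptab (take_nth 0) ?size_one_line // -cats1 foldl_cat.
Qed.

Lemma ptab_full : ptab N = (RS (one_line p)).1.
Proof.
have fst_foldl s PQ : (foldl rs_step PQ s).1 =
    foldl (fun T x => (tab_insert T x).1) PQ.1 (unzip2 s).
  by elim: s PQ => [|jx s IH] PQ //=; rewrite IH /rs_step; case: tab_insert.
rewrite /ptab /RS fst_foldl unzip2_zip ?size_iota //.
by rewrite take_oversize ?size_one_line.
Qed.

Lemma pH_eq0 i j : i < N -> j < N -> pmat p i j ->
  forall j', j' <= j -> pH p i j' = 0.
Proof.
move=> iN jN Mij j' le_j'j.
have [e _] := pgridV p^-1%g i j'; rewrite invgK in e.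
rewrite e // ?(leq_trans le_j'j) 1?ltnW //.
by apply: pV_eq0 le_j'j => //; rewrite pmatV.
Qed.

(** The invariant tying insertion to the grid: vertical labels give the row of each value, with 0
    for values not yet inserted. *)
Let grid_tab i T := [/\ all (sorted ltn) T,
    forall k z, z \in nth [::] T k -> 0 < z <= N
  & forall k j, j < N -> (j.+1 \in nth [::] T k) = (pV p i j == k.+1)].

(** In column i the carry is 0 below the point, so smaller values keep their rows. The point starts
    a carry 1, which is insertion into row 0, and [tab_insert_scan] follows it upwards. *)
Let grid_tab_step (i : 'I_N) T : grid_tab i T ->
  grid_tab i.+1 (tab_insert T (p i).+1).1 /\
  pH p i N = (tab_insert T (p i).+1).2.+1.
Proof.
case=> sT bd mem; have Mi : pmat p i (p i) by rewrite pmatE.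
have step j : p i < j < N ->
    (pH p i j.+1, pV p i.+1 j) = cross (pH p i j) (pV p i j) false.
  case/andP=> lt jN; rewrite pgridE; congr cross; apply/negP => Mij.
  by have := pmat_inj2 (ltn_ord i) jN (ltn_ord (p i)) Mij Mi; lia.
have Vi := pV_eq0 (ltn_ord i) (ltn_ord (p i)) Mi (leqnn i).
have Hi := pH_eq0 (ltn_ord i) (ltn_ord (p i)) Mi.
have [Hi1 Vi1] : pH p i (p i).+1 = 1 /\ pV p i.+1 (p i) = 1.
  have := pgridE p i (p i); rewrite Vi (Hi _ (leqnn _)) Mi.
  by case: (pH p i _) (pV p i.+1 _) => [|?] [|?] // [-> ->].
have [||sT' hN bd' mem'] :=
  @tab_insert_scan N (pH p i) (pV p i) (pV p i.+1) T 0 (p i) (ltn_ord _) sT bd _ Hi1 step.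
- by move=> k; rewrite mem // Vi.
- by move=> k j /andP[_ jN]; rewrite mem.
split; last by [].
split=> // k j jN; rewrite mem' // add0n.
have [lt|//|->] := ltngtP j (p i); last by rewrite Vi1 eqSS eq_sym.
rewrite mem //; congr (_ == _); have := pgridE p i j; rewrite (Hi j (ltnW lt)).
have -> : pmat p i j = false.
  by apply/negP => /(pmat_inj2 (ltn_ord i) jN (ltn_ord (p i)))/(_ Mi); lia.
by move: (pV p i.+1 j) (pV p i j) => v' [|v] [].
Qed.

Lemma ptab_grid (i : nat) : i <= N -> grid_tab i (ptab i).
Proof.
elim: i => [|i IH] iN.
  by rewrite /ptab take0 /=; split=> // [k z|k j _]; rewrite nth_nil.
have [] := grid_tab_step (i := Ordinal iN) (IH (ltnW iN)).
by rewrite ptabS // (nth_one_line (Ordinal iN)).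
Qed.

Lemma nth_shape_ptab i r : i <= N ->
  nth 0 (shape (ptab i)) r = count_mem r.+1 (take i (qword p)).
Proof.
elim: i => [|i IH] iN; first by rewrite /ptab !take0 nth_nil.
rewrite ptabS // shape_tab_insert nth_incr_nth IH ?(ltnW iN) //.
rewrite (take_nth 0) ?size_mkseq // count_mem_rcons nth_mkseq //.
have [_ /= ->] := grid_tab_step (i := Ordinal iN) (ptab_grid (ltnW iN)).
by rewrite eqSS addnC (nth_one_line (Ordinal iN)).
Qed.

Lemma nth_sh r : nth 0 (sh p) r = count_mem r.+1 (qword p).
Proof.
by rewrite /sh -ptab_full nth_shape_ptab // take_oversize ?size_mkseq.
Qed.

(** Without trailing zeros, a shape can be recovered from its parts read with default 0. *)
Lemma sh_last_neq0 : sh p != [::] -> nth 0 (sh p) (size (sh p)).-1 != 0.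
Proof.
rewrite /sh -ptab_full /ptab; elim/last_ind: (take _ _) => // w x IH _.
rewrite -cats1 foldl_cat /= shape_tab_insert; move: (foldl _ _ _) (_.2) IH.
move=> T k IH; rewrite size_incr_nth nth_incr_nth.
case: ltnP => [lt_k|_]; last by rewrite eqxx.
by rewrite addn_eq0 negb_and IH ?orbT //; case: (shape T) lt_k.
Qed.

End PermTableau.

(** * Schensted's theorem *)

Definition first_row (w : seq nat) : seq nat :=
  foldl (fun r x => (row_insert r x).1) [::] w.

Lemma first_row_rcons w x :
  first_row (rcons w x) = (row_insert (first_row w) x).1.
Proof. by rewrite /first_row -cats1 foldl_cat. Qed.

Lemma row_insert_set_nth r x :
  (row_insert r x).1 = set_nth 0 r (find (ltn x) r) x.
Proof.
elim: r => //= y r IH; case: ifP => //= _.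
by case: row_insert IH => r' b /= ->.
Qed.

Lemma first_row_sorted (w : seq nat) : uniq w ->
  sorted ltn (first_row w) /\ {subset first_row w <= w}.
Proof.
elim/last_ind: w => // w x IH; rewrite rcons_uniq => /andP[xw /IH[sr sub]].
have xr : x \notin first_row w by apply: contra xw => /sub.
rewrite first_row_rcons; have [sr' mem _] := row_insertP sr xr.
split=> // z; rewrite mem mem_rcons inE => /orP[->//|/andP[/sub ->]].
by rewrite orbT.
Qed.

Lemma subseq_rcons2 (s w : seq nat) (x y : nat) :
  subseq (rcons s y) (rcons w x) = subseq (if y == x then s else rcons s y) w.
Proof.
rewrite -subseq_rev !rev_rcons /= -[RHS]subseq_rev.
by case: eqP; rewrite ?rev_rcons.
Qed.

(* Schensted's invariant: the entry in column [c] of the first row is the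
   least last term of an increasing subsequence of length [c.+1]. *)
Lemma first_row_ex (w : seq nat) : uniq w -> forall c, c < size (first_row w) ->
  exists s : seq nat, [/\ subseq s w, sorted ltn s, size s = c.+1
              & last 0 s = nth 0 (first_row w) c].
Proof.
elim/last_ind: w => // w x IH; rewrite rcons_uniq => /andP[xw uw] c.
have [sr sub] := first_row_sorted uw.
rewrite first_row_rcons row_insert_set_nth size_set_nth nth_set_nth /=.
set r := first_row w in sr sub *; set k := find _ _.
have kr : k <= size r by apply: find_size.
case: (eqVneq c k) => [-> _|nck lt_c]; last first.
  have [|s [sw ss szs ls]] := IH uw c; first by rewrite -/r; lia.
  by exists s; split=> //; apply: subseq_trans sw (subseq_rcons _ _).
case kE: k => [|k'].
  exists [:: x]; split=> //.
  by rewrite sub1seq mem_rcons mem_head.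
have lt_k'r : k' < size r by lia.
(* The entry just left of the insertion place is less than [x], so a subsequence ending in it can be
   prolonged by [x]. *)
have [//|s [sw ss szs ls]] := IH uw k'.
exists (rcons s x); split; rewrite ?size_rcons ?szs ?last_rcons //.
  by rewrite subseq_rcons2 eqxx.
case: s ss szs ls {sw} => //= y s; rewrite rcons_path => -> _ -> /=.
have := @before_find _ 0 (ltn x) r k'; rewrite -/k kE => /(_ (ltnSn _)) /=.
have : nth 0 r k' != x.
  apply: contraNneq xw => <-; apply: sub; exact: mem_nth.
rewrite -/r; lia.
Qed.

(** The minimality half of the invariant. Only subsequences ending in the new letter require an
    argument, since insertion never raises an existing entry of the row. *)
Lemma first_row_max (w : seq nat) : uniq w ->
  forall s : seq nat, subseq s w -> sorted ltn s -> s != [::] ->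
  size s <= size (first_row w) /\ nth 0 (first_row w) (size s).-1 <= last 0 s.
Proof.
elim/last_ind: w => [_ s|w x IH]; first by rewrite subseq0 => /eqP ->.
rewrite rcons_uniq => /andP[xw uw].
have [sr sub] := first_row_sorted uw.
rewrite first_row_rcons row_insert_set_nth; set r := first_row w in sr sub *.
move=> s; rewrite size_set_nth nth_set_nth /=; set k := find _ _.
have kr : k <= size r by apply: find_size.
have le_k c : c < k -> nth 0 r c <= x.
  by move/(@before_find _ 0 (ltn x) r) => /=; lia.
have lt_k : k < size r -> x < nth 0 r k.
  by rewrite -has_find => /(nth_find 0).
case/lastP: s => // s y; rewrite subseq_rcons2 size_rcons last_rcons /=.
case: (eqVneq y x) => [-> sw ss _|nyx sw ss ne]; last first.
  have [] := IH uw _ sw ss ne; rewrite size_rcons last_rcons -/r /=.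
  move=> szs le_y; split; first by lia.
  case: (eqVneq (size s) k) => [e|_] //; move: lt_k le_y; rewrite -e => /(_ szs).
  by lia.
(* The letter [x] lands in column [k]. If [k] were less than [size s], the entry bumped there would
   be at most the last term of [s], hence less than [x]. *)
suff szs : size s <= k.
  split; first by lia.
  by case: (eqVneq (size s) k) => // ne; apply: le_k; lia.
case: (eqVneq s [::]) => [->//|nes].
case/lastP: s nes sw ss => // s z _ sw ss.
have [] := IH uw _ sw; rewrite ?size_rcons ?last_rcons -/r /=.
- by move: ss; rewrite -cats1 => /cat_sorted2[].
- by case: (s).
move=> szs le_z; rewrite ltnNge; apply/negP => le_ks.
have lt_zx : z < x.
  by case: s ss {sw szs le_z le_ks} => [|a s] /=; rewrite ?rcons_path ?last_rcons => /andP[].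
have : nth 0 r k <= nth 0 r (size s).
  move: le_ks; rewrite leq_eqVlt => /orP[/eqP->//|lt_ks].
  by apply: ltnW; rewrite (sorted_ltn_nth ltn_trans) ?inE //; lia.
by have := lt_k; lia.
Qed.

Section Schensted.
Variables (N : nat) (p : 'S_N).

Lemma one_line_uniq : uniq (one_line p).
Proof. by rewrite map_inj_uniq ?enum_uniq // => i j [/val_inj/perm_inj]. Qed.

(** Bumped entries only move down, so the first row evolves by [row_insert] alone. *)
Lemma size_first_row : size (first_row (one_line p)) = nth 0 (sh p) 0.
Proof.
rewrite /sh -ptab_full.
have nth0_shape (T : tableau) : nth 0 (shape T) 0 = size (nth [::] T 0).
  by case: T.
rewrite nth0_shape /ptab take_oversize ?size_one_line // /first_row.
congr size; have foldlE w (T : tableau) :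
    foldl (fun r x => (row_insert r x).1) (nth [::] T 0) w =
    nth [::] (foldl (fun T x => (tab_insert T x).1) T w) 0.
  elim: w T => //= x w IH T; rewrite -IH; congr (foldl _ _ _).
  by case: T => [|r T] //=; case: row_insert => r' [y|] //=; case: tab_insert.
exact: (foldlE _ [::]).
Qed.

Let enumE (A : pred 'I_N) : enum A = filter A (enum 'I_N).
Proof. by rewrite [in RHS]/enum_mem filter_predT. Qed.

Lemma val_enum_sorted (A : pred 'I_N) : sorted (fun i j : 'I_N => i < j) (enum A).
Proof.
have : sorted (fun i j : 'I_N => i < j) (enum 'I_N).
  by have := iota_ltn_sorted 0 N; rewrite -val_enum_ord sorted_map.
by rewrite (enumE A); apply: sorted_filter => i j k; apply: ltn_trans.
Qed.

Lemma lis_sh : lis p = nth 0 (sh p) 0.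
Proof.
rewrite -size_first_row; apply/eqP; rewrite eqn_leq; apply/andP; split.
  apply/bigmax_leqP => A /forall_inP incA.
  case: (eqVneq A set0) => [->|/set0Pn[a aA]]; first by rewrite cards0.
  have [] := first_row_max one_line_uniq (s := [seq (p i).+1 | i <- enum A]).
  - by apply: map_subseq; rewrite (enumE (mem A)); apply: filter_subseq.
  - rewrite sorted_map; apply: (sub_in_sorted (P := mem A)) (val_enum_sorted (mem A)).
      move=> i j iA jA lt_ij /=.
      by have /forall_inP/(_ j jA)/implyP/(_ lt_ij) := incA i iA.
    by apply/allP => i; rewrite mem_enum.
  - by rewrite -size_eq0 size_map -cardE -lt0n; apply/card_gt0P; exists a.
  - by rewrite size_map -cardE.
case E: (size (first_row (one_line p))) => [//|c].
have [|s [sw ss szs _]] := first_row_ex one_line_uniq (c := c); first by rewrite E.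
case/subseqP: sw => m _ sE; rewrite -map_mask in sE.
set t := mask m (enum 'I_N) in sE.
have tV : sorted (fun i j : 'I_N => i < j) t.
  apply: sorted_mask => [i j k|]; [exact: ltn_trans | exact: val_enum_sorted].
have ut : uniq t by rewrite mask_uniq ?enum_uniq.
rewrite -szs sE size_map -(card_uniqP ut) -(cardsE (mem t)).
apply: leq_bigmax_cond; apply/forall_inP => i; rewrite inE => it.
apply/forall_inP => j; rewrite inE => jt; apply/implyP => lt_ij.
move: ss; rewrite sE sorted_map => st.
(* The list [t] is sorted both by position and by value, so the order of indices in [t] decides both
   comparisons. *)
have [lt|lt|e] := ltngtP (index i t) (index j t).
- have tr : transitive (relpre (fun i => (p i).+1) ltn).
    by move=> a b d; apply: ltn_trans.
  exact: (sorted_ltn_index tr st i j it jt lt).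
- have tr : transitive (fun i j : 'I_N => i < j).
    by move=> a b d; apply: ltn_trans.
  by have := sorted_ltn_index tr tV j i jt it lt; lia.
- by move: lt_ij; rewrite (index_inj i it jt e) ltnn.
Qed.

End Schensted.

(** * Counting lattice words *)

(** Meant for positive letters [l]: each of 3, ..., c + 2 occurs once, by coercion of the
    boolean. *)
Definition dhook_content (a b c l : nat) : nat :=
  if l == 1 then a else if l == 2 then b else l <= c.+2.

(* The lattice words of content [(a, b, 1^c)], by their last letter; the fuel
   [N] is meant to be [a + b + c]. *)
Fixpoint dhook_words (N a b c : nat) : seq (seq nat) :=
  if N is N'.+1 then
    (if b < a then [seq rcons w 1 | w <- dhook_words N' a.-1 b c] else [::]) ++
    (if (0 < b) && ((1 < b) || (c == 0))
     then [seq rcons w 2 | w <- dhook_words N' a b.-1 c] else [::]) ++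
    (if 0 < c then [seq rcons w c.+2 | w <- dhook_words N' a b c.-1] else [::])
  else [:: [::]].

Lemma mem_map_rcons (L : seq (seq nat)) (w : seq nat) (x k : nat) :
  (rcons w x \in [seq rcons u k | u <- L]) = (x == k) && (w \in L).
Proof.
apply/mapP/andP => [[u uL /rcons_inj[-> ->]]|[/eqP -> wL]]; first by [].
by exists w.
Qed.

Lemma nil_map_rcons (L : seq (seq nat)) (k : nat) :
  ([::] \in [seq rcons u k | u <- L]) = false.
Proof. by apply/mapP => -[[|x u] _]. Qed.

(** The last letter of a lattice word marks a removable cell of its shape, and the shapes (a, b,
    1^c), unlike the double hooks alone, are closed under such removals. *)
Lemma mem_dhook_words N a b c w : N = a + b + c -> b <= a -> (0 < c -> 0 < b) ->
  w \in dhook_words N a b c <->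
  [/\ size w = N, lattice w, 0 \notin w
    & forall l, 0 < l -> count_mem l w = dhook_content a b c l].
Proof.
elim: N a b c w => [|N IH] a b c w.
  move=> N0 _ _; rewrite /= inE; split=> [/eqP ->|[/size0nil -> //]].
  split=> // l l0; rewrite /dhook_content /=; do ?case: eqP; lia.
move=> NE le_ba c_b /=; rewrite !mem_cat.
case/lastP: w => [|w x].
  split=> [|[]//]; do 3 (case: ifP => _); by rewrite ?nil_map_rcons ?in_nil.
rewrite size_rcons mem_rcons inE negb_or.
have mem_if (P : bool) k L :
    (rcons w x \in (if P then [seq rcons w k | w <- L] else [::])) =
    [&& P, x == k & w \in L].
  by case: P; rewrite ?in_nil ?mem_map_rcons.
rewrite !{}mem_if; split.
  case/or3P => /and3P[cond /eqP -> wL].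
  - have [|||sw lw w0 cw] := (IH a.-1 b c w _ _ _).1 wL => //; try lia.
    split; [by rewrite sw | by apply/lattice_rcons | by [] |] => l l0.
    by rewrite count_mem_rcons cw // /dhook_content; do ?case: eqP; lia.
  - have [|||sw lw w0 cw] := (IH a b.-1 c w _ _ _).1 wL => //; try lia.
    split; [by rewrite sw | apply/lattice_rcons; split=> // _ | by [] |] => [|l l0].
      by rewrite !cw // /dhook_content /=; lia.
    by rewrite count_mem_rcons cw // /dhook_content; do ?case: eqP; lia.
  - have [|||sw lw w0 cw] := (IH a b c.-1 w _ _ _).1 wL => //; try lia.
    split; [by rewrite sw | apply/lattice_rcons; split=> // _ | by [] |] => [|l l0].
      by rewrite !cw // /dhook_content /=; do ?case: eqP; lia.
    by rewrite count_mem_rcons cw // /dhook_content; do ?case: eqP; lia.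
case=> [[sw]] /lattice_rcons[lw _] /andP[x0 w0] cw.
have {}cw l : 0 < l -> count_mem l w + (x == l) = dhook_content a b c l.
  by move=> l0; rewrite -count_mem_rcons cw.
have lwN l : 0 < l -> count_mem l.+1 w <= count_mem l w.
  by move=> l0; have := lw (size w) l l0; rewrite take_size.
have [x1|nx1] := eqVneq x 1.
  have := lwN 1 isT; have := cw 1 isT; have := cw 2 isT; rewrite x1 /dhook_content /= => c2 c1 l21.
  have lt_ba : b < a by lia.
  rewrite lt_ba /=; apply/orP; left; apply/IH; try lia; split=> // l l0.
  by have := cw l l0; rewrite x1 /dhook_content; do ?case: eqP; lia.
have [x2|nx2] := eqVneq x 2.
  have := lwN 2 isT; have := cw 2 isT; have := cw 3 isT; rewrite x2 /dhook_content /= => c3 c2 l32.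
  have cond : (0 < b) && ((1 < b) || (c == 0)) by lia.
  rewrite cond /=; apply/orP; right; apply/orP; left; apply/IH; try lia; split=> // l l0.
  by have := cw l l0; rewrite x2 /dhook_content; do ?case: eqP; lia.
have x_gt2 : 2 < x by lia.
have xpos : 0 < x by lia.
(* A last letter above 2 occurs only once, so by the lattice property its successor does not occur,
   and it is the largest letter. *)
have lx := lwN x xpos; have cx := cw x xpos; have cSx := cw x.+1 isT.
rewrite /dhook_content (negPf nx1) (negPf nx2) eqxx in cx.
rewrite /dhook_content !eqSS (negPf nx1) (gtn_eqF xpos) (ltn_eqF (ltnSn x)) in cSx.
have xE : x = c.+2 by lia.
have cond : 0 < c by lia.
rewrite cond xE eqxx /=; apply/orP; right; apply/orP; right; apply/IH; try lia; split=> // l l0.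
by have := cw l l0; rewrite xE /dhook_content; do ?case: eqP; lia.
Qed.

Lemma dhook_words_uniq N a b c : uniq (dhook_words N a b c).
Proof.
elim: N a b c => //= N IH a b c.
have uniq_if (P : bool) k L : uniq L ->
    uniq (if P then [seq rcons w k | w <- L] else [::]).
  by case: P => // uL; rewrite map_inj_uniq // => u v /rcons_inj[].
have last_if (P : bool) k L (w : seq nat) :
    w \in (if P then [seq rcons w k | w <- L] else [::]) -> last 0 w = k.
  by case: P => // /mapP[u _ ->]; rewrite last_rcons.
rewrite !cat_uniq !uniq_if // !andbT /=; apply/andP; split; apply/hasPn => w.
  rewrite mem_cat => w23; apply/negP => /last_if w1.
  by case/orP: w23 => /last_if; rewrite w1.
case: ifP => // c0 /mapP[u _ ->]; apply/negP => /last_if.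
by rewrite last_rcons; lia.
Qed.

Lemma size_dhook_words0 a : size (dhook_words a a 0 0) = 1.
Proof. by elim: a => //= a IH; rewrite cats0 size_map. Qed.

Lemma size_dhook_wordsS N a b c : size (dhook_words N.+1 a b c) =
  (if b < a then size (dhook_words N a.-1 b c) else 0) +
  (if (0 < b) && ((1 < b) || (c == 0)) then size (dhook_words N a b.-1 c) else 0) +
  (if 0 < c then size (dhook_words N a b c.-1) else 0).
Proof.
by rewrite /= !size_cat addnA; do 3!case: ifP => _; rewrite ?size_map.
Qed.

(** Base case of the hook length formula: here removing a cell may empty the second row, and the
    general step divides by b + c. *)
Lemma size_dhook_words1 d : size (dhook_words d.+2 d.+1 1 0) = d.+1.
Proof.
elim: d => [//|d IH]; rewrite size_dhook_wordsS !succnK size_dhook_words0.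
by rewrite ltnS ltn0Sn IH addn0 addn1.
Qed.

Section Size.
Import GRing.Theory Num.Theory.
Local Open Scope ring_scope.

(* The hook length formula for the shape [(b + d + 1, b + 1, 1^c)]. *)
Lemma size_dhook_words M b d c : M = (b + d + b.+1 + c)%N ->
  (size (dhook_words M.+1 (b + d).+1 b.+1 c))%:R =
  (M.+1)`!%:R * d.+1%:R /
    ((b + d).+1`!%:R * b`!%:R * c`!%:R * (b + d + c).+2%:R * (b + c).+1%:R) :> rat.
Proof.
elim: M b d c => [|M IH] b d c ME; first by lia.
have fN0 (n : nat) : n`!%:R != 0 :> rat by rewrite pnatr_eq0 -lt0n fact_gt0.
have ge0 (n : nat) : 0 <= n%:R :> rat by rewrite ler0n.
have [/andP[/eqP b0 /eqP c0]|bc0] := boolP ((b == 0%N) && (c == 0%N)).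
  have Md : M = d by lia.
  subst b c M; rewrite !add0n !addn0 size_dhook_words1 !factS !natrM.
  move: (fN0 d) (ge0 d); move: d`!%:R => A A0; rewrite -!natr1; move: d%:R => x x0.
  by field; rewrite A0 !lt0r_neq0 //; lra.
rewrite size_dhook_wordsS 2![in LHS]natrD !succnK.
pose D := (b + d).+1`!%:R * b`!%:R * c`!%:R : rat.
pose K := (M.+1)`!%:R / D.
(* In [F1], [F2] and [F3] the factors d, b and c vanish exactly when the corresponding cell is not
   removable, so each closed form also covers the absent branch. *)
have F1 : (if (b.+1 < (b + d).+1)%N then size (dhook_words M.+1 (b + d) b.+1 c)
           else 0%N)%:R
    = K * d%:R * (b + d).+1%:R / ((b + d + c).+1%:R * (b + c).+1%:R) :> rat.
  rewrite /K /D; case: d ME {D K} => [|d] ME; first by rewrite addn0 ltnn mulr0 !mul0r.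
  rewrite addnS !ltnS leq_addr IH; last by lia.
  rewrite !factS addSn !natrM.
  move: (fN0 M) (fN0 (b + d)%N) (fN0 b) (fN0 c).
  move: M`!%:R (b + d)`!%:R b`!%:R c`!%:R => A B C E A0 B0 C0 E0.
  have := (ge0 b, ge0 c, ge0 d, ge0 M).
  rewrite -!natr1 !natrD.
  move: b%:R c%:R d%:R M%:R => x y z w [[[x0 y0] z0] w0].
  by field; rewrite ?A0 ?B0 ?C0 ?E0 !lt0r_neq0 //=; lra.
have F2 : (if (0 < b.+1)%N && ((1 < b.+1)%N || (c == 0%N))
           then size (dhook_words M.+1 (b + d).+1 b c) else 0%N)%:R
    = K * d.+2%:R * b%:R / ((b + d + c).+2%:R * (b + c)%:R) :> rat.
  rewrite /K /D; case: b bc0 ME {D K F1} => [|b] bc0 ME.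
    by rewrite eqxx /= in bc0; rewrite ltnn (negPf bc0) andbF mulr0 !mul0r.
  have -> : ((b.+1 + d).+1 = (b + d.+1).+1)%N by lia.
  rewrite /= IH; last by lia.
  rewrite !factS addSn !natrM.
  move: (fN0 M) (fN0 (b + d.+1)%N) (fN0 b) (fN0 c).
  move: M`!%:R (b + d.+1)`!%:R b`!%:R c`!%:R => A B C E A0 B0 C0 E0.
  have := (ge0 b, ge0 c, ge0 d, ge0 M).
  rewrite addSn -!natr1 !natrD -!natr1.
  move: b%:R c%:R d%:R M%:R => x y z w [[[x0 y0] z0] w0].
  by field; rewrite ?A0 ?B0 ?C0 ?E0 !lt0r_neq0 //=; lra.
have F3 : (if (0 < c)%N then size (dhook_words M.+1 (b + d).+1 b.+1 c.-1) else 0%N)%:R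
    = K * d.+1%:R * c%:R / ((b + d + c).+1%:R * (b + c)%:R) :> rat.
  rewrite /K /D; case: c bc0 ME {D K F1 F2} => [|c] bc0 ME; first by rewrite mulr0 !mul0r.
  rewrite /= IH; last by lia.
  rewrite !factS !natrM.
  move: (fN0 M) (fN0 (b + d)%N) (fN0 b) (fN0 c).
  move: M`!%:R (b + d)`!%:R b`!%:R c`!%:R => A B C E A0 B0 C0 E0.
  have := (ge0 b, ge0 c, ge0 d, ge0 M).
  rewrite !addnS -!natr1 !natrD.
  move: b%:R c%:R d%:R M%:R => x y z w [[[x0 y0] z0] w0].
  by field; rewrite ?A0 ?B0 ?C0 ?E0 !lt0r_neq0 //=; lra.
rewrite {}F1 {}F2 {}F3 /K -/D {K} [((M.+2)`!)%N]factS natrM.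
move: (M.+1)`!%:R => A; have {ME} -> : M = (b + d + b + c)%N by lia.
have D0 : D != 0 by rewrite !mulf_neq0.
have bc : 0 < b%:R + c%:R :> rat by rewrite -natrD ltr0n; lia.
move: D D0 => D D0.
have := (ge0 b, ge0 c, ge0 d); rewrite -!natr1 !natrD.
move: b%:R c%:R d%:R bc => x y z bc [[x0 y0] z0].
by field; rewrite ?D0 !lt0r_neq0 //=; lra.
Qed.

End Size.

(** * Log concavity *)

Definition dhook_count (n k : nat) : nat :=
  size (dhook_words (2 * n) k k (2 * n - 2 * k)).

Section LogConcavity.
Import GRing.Theory Num.Theory.
Local Open Scope ring_scope.

Lemma dhook_countE n k : (k < n)%N -> (dhook_count n k.+1)%:R =
  (2 * n)`!%:R / (k.+1`!%:R * k`!%:R * (2 * n - 2 * k.+1)`!%:R *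
    (2 * n - k)%:R * (2 * n - k.+1)%:R) :> rat.
Proof.
move=> lt_kn; rewrite /dhook_count; set c := (2 * n - 2 * k.+1)%N.
have -> : (2 * n = (k + 0 + k.+1 + c).+1)%N by lia.
rewrite -[X in dhook_words _ X.+1]addn0 size_dhook_words //.
rewrite addn0 mulr1; congr (_ / (_ * _%:R * _%:R)); lia.
Qed.

Lemma dhook_count_log_concave n k : (1 < k < n)%N ->
  (dhook_count n k.-1 * dhook_count n k.+1 <= dhook_count n k ^ 2)%N.
Proof.
(* With these parameters all truncated subtractions become sums. *)
move=> kn; have [j [t [kE nE]]] : exists j t, k = j.+2 /\ n = (j + t).+3.
  by exists (k - 2)%N, (n - k - 1)%N; lia.
rewrite -(ler_nat rat) natrM natrX kE /= !dhook_countE; try lia.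
have -> : (2 * n - j = j + t.*2 + 6)%N by lia.
have -> : (2 * n - j.+1 = j + t.*2 + 5)%N by lia.
have -> : (2 * n - j.+2 = j + t.*2 + 4)%N by lia.
have -> : (2 * n - j.+3 = j + t.*2 + 3)%N by lia.
have -> : (2 * n - 2 * j.+1 = t.*2.+4)%N by lia.
have -> : (2 * n - 2 * j.+2 = t.*2.+2)%N by lia.
have -> : (2 * n - 2 * j.+3 = t.*2)%N by lia.
move: (2 * n)`!%:R => A; move: (t.*2) => s.
have fN0 (m : nat) : m`!%:R != 0 :> rat by rewrite pnatr_eq0 -lt0n fact_gt0.
rewrite !factS !natrM; move: (fN0 j) (fN0 s); move: j`!%:R s`!%:R => B C B0 C0.
have : 0 <= j%:R :> rat by rewrite ler0n.
have : 0 <= s%:R :> rat by rewrite ler0n.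
rewrite !natrD -!natr1; move: j%:R s%:R => x y y0 x0.
set F := (X in _ <= X ^+ 2).
(* After cancelling factorials, [P / Q] is the ratio of the product of the two neighbours to the
   square of the middle term. *)
pose P := (y + 2) * (y + 1) * ((x + 1) * ((x + y + 5) * (x + y + 4))).
pose Q := (y + 4) * (y + 3) * ((x + 3) * ((x + y + 6) * (x + y + 3))).
have Q0 : 0 < Q by rewrite /Q !mulr_gt0 //; lra.
rewrite [leLHS](_ : _ = F ^+ 2 * (P / Q)); last first.
  by rewrite /F /P /Q; field; rewrite ?B0 ?C0 !lt0r_neq0 //=; lra.
rewrite ler_piMr ?sqr_ge0 // ler_pdivrMr // mul1r /P /Q.
have xy : 0 <= x * y by rewrite mulr_ge0.
(* The quotient of the factors in x + y exceeds 1, so it has to be compared jointly with (x + 1) /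
   (x + 3). *)
apply: ler_pM; rewrite ?mulr_ge0 //; try lra; nra.
Qed.

End LogConcavity.

(** * Permutations and involutions of double hook shape *)

Section Counting.
Variables (n k : nat).
Hypothesis kn : 1 <= k <= n.
Implicit Types p : 'S_(2 * n).

Lemma nth_double_hook r :
  nth 0 (double_hook n k) r = dhook_content k k (2 * n - 2 * k) r.+1.
Proof.
by case: r => [|[|r]] //=; rewrite nth_nseq /dhook_content /= !ltnS; case: ltnP.
Qed.

Lemma sh_double_hook p :
  sh p == double_hook n k <->
  forall l, 0 < l ->
    count_mem l (qword p) = dhook_content k k (2 * n - 2 * k) l.
Proof.
split=> [/eqP shp [//|r] _|cont]; first by rewrite -nth_sh shp nth_double_hook.
have nthE r : nth 0 (sh p) r = nth 0 (double_hook n k) r.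
  by rewrite nth_sh cont // nth_double_hook.
have dh_neq0 i : i < size (double_hook n k) -> nth 0 (double_hook n k) i != 0.
  move=> lti; apply: contraTneq (mem_nth 0 lti) => ->.
  rewrite mem_cat !inE negb_or; apply/andP; split; first by lia.
  by apply/nseqP; case.
apply/eqP/(@eq_from_nth _ 0) => //.
have [lt|lt|//] := ltngtP (size (sh p)) (size (double_hook n k)).
  by have := dh_neq0 _ lt; rewrite -nthE nth_default.
have := @sh_last_neq0 _ p; rewrite nthE nth_default ?eqxx; first last.
  by rewrite -ltnS prednK //; apply: leq_ltn_trans lt.
by rewrite -size_eq0; case: (size (sh p)) lt => // m _ /(_ isT).
Qed.

(** By Schensted's theorem [lis p] is the first part of the shape, which for a double hook is its
    parameter. *)
Lemma lis_dhook p :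
  (lis p == k) && (sh p \in dhook n) = (sh p == double_hook n k).
Proof.
apply/andP/eqP => [[/eqP lisp /existsP[k' /andP[k'0 /eqP shp]]]|shp].
  by move: lisp; rewrite lis_sh shp /= => ->.
split; first by rewrite lis_sh shp.
have lt_kn : k < n.+1 by lia.
by apply/existsP; exists (Ordinal lt_kn); rewrite shp eqxx andbT; case/andP: kn.
Qed.

Let L := dhook_words (2 * n) k k (2 * n - 2 * k).

Let mem_L w : w \in L <->
  [/\ size w = 2 * n, lattice w, 0 \notin w
    & forall l, 0 < l -> count_mem l w = dhook_content k k (2 * n - 2 * k) l].
Proof. by apply: mem_dhook_words; lia. Qed.

Let qword_L p : (qword p \in L) = (sh p == double_hook n k).
Proof.
apply/idP/idP => [/mem_L[_ _ _ cont]|/sh_double_hook cont]; last apply/mem_L.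
  exact/sh_double_hook.
by split=> //; [rewrite size_mkseq | apply: qword_lattice | apply: qword_gt0].
Qed.

Let shV p : (sh p^-1%g == double_hook n k) = (sh p == double_hook n k).
Proof.
by apply/idP/idP => /sh_double_hook c; apply/sh_double_hook => l l0;
  rewrite -c // qword_content.
Qed.

Let qword_onto u v : u \in L -> v \in L ->
  exists p, qword p = u /\ qword p^-1%g = v.
Proof.
move=> /mem_L[su lu u0 cu] /mem_L[sv lv v0 cv].
by apply: qword_surj => // l l0; rewrite cu ?cv.
Qed.

(** Sending [p] to the words of [p] and of its inverse is a bijection onto the pairs of words in
    [L]. *)
Lemma ell_dhookE : ell_dhook n k = dhook_count n k ^ 2.
Proof.
rewrite /ell_dhook cardE -(size_map (fun p => (qword p, qword p^-1%g))).
rewrite expnS expn1 /dhook_count -/L -(size_allpairs pair); apply/perm_size/uniq_perm.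
- rewrite map_inj_uniq ?enum_uniq // => p p' [e e']; exact: qword_inj.
- by rewrite allpairs_uniq ?dhook_words_uniq // => -[u v] [u' v'] _ _ [-> ->].
move=> [u v]; apply/mapP/allpairsP => [[p]|[[u' v'] /= [uL vL [-> ->]]]].
  rewrite mem_enum inE lis_dhook => shp [-> ->].
  by exists (qword p, qword p^-1%g); rewrite /= !qword_L shV shp.
have [p [pu pV]] := qword_onto uL vL; exists p; last by rewrite pu pV.
by rewrite mem_enum inE lis_dhook -qword_L pu.
Qed.

Lemma inv_dhookE : inv_dhook n k = dhook_count n k.
Proof.
have invP p : (p * p == 1)%g = (p^-1 == p)%g.
  by rewrite eq_invg_mul.
rewrite /inv_dhook cardE -(size_map (@qword _)) /dhook_count -/L.
apply/perm_size/uniq_perm; last 1 first.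
- move=> u; apply/mapP/idP => [[p]|uL].
    by rewrite mem_enum inE lis_dhook => /andP[_ shp] ->; rewrite qword_L.
  have [p [pu pV]] := qword_onto uL uL; exists p => //.
  rewrite mem_enum inE lis_dhook -qword_L pu uL andbT invP.
  (* The permutation with pair (u, u) and its inverse have the same pair, so they coincide. *)
  by apply/eqP/qword_inj; rewrite ?invgK pu pV.
- rewrite map_inj_in_uniq ?enum_uniq // => p p'; rewrite !mem_enum !inE !invP.
  by move=> /andP[/eqP pV _] /andP[/eqP p'V _] e; apply: qword_inj; rewrite ?pV ?p'V.
- exact: dhook_words_uniq.
Qed.

End Counting.

Local Open Scope ring_scope.
Import GRing.Theory Num.Theory.

Lemma log_concave_nat (R : numDomainType) (n : nat) (l : nat -> nat) :
    (forall k, (1 < k < n)%N -> (l k.-1 * l k.+1 <= l k ^ 2)%N) ->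
  log_concave n (fun k => (l k)%:R : R).
Proof.
move=> lc k kn; rewrite /zero_ext kn.
have [k1|] := ifP; last by rewrite mul0r exprn_ge0 ?ler0n.
have [k2|] := ifP; last by rewrite mulr0 exprn_ge0 ?ler0n.
by rewrite -natrM -natrX ler_nat lc //; lia.
Qed.

Theorem theorem4p4 (R : realType) (n : nat) (hn : (1 <= n)%N) :
  log_concave n (fun k => (ell_dhook n k)%:R : R) /\
  log_concave n (fun k => (inv_dhook n k)%:R : R).
Proof.
split; apply: log_concave_nat => k kn.
  rewrite !ell_dhookE; try lia.
  by rewrite -expnMn leq_sqr dhook_count_log_concave.
by rewrite !inv_dhookE; try lia; rewrite dhook_count_log_concave.
Qed.
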